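(* Let $\psi:\mathbb{R}_+\to\mathbb{R}$ be an upper semi-continuous, concave, non-decreasing function with $\psi(0)=0$, and suppose there is $u'>0$ and a constant $c$ with $\psi(u)=c$ for all $u\in[u',\infty)$. Then the problem $$\text{minimize }\beta\quad\text{s.t.}\quad \int_0^uy(s)\,ds-\psi^*(y(u))\le\beta\,\psi(u)\ \ \forall u\in[0,\infty),\quad y\in C[0,\infty)$$ is equivalent (has the same optimal value) to the problem $$\text{minimize }\beta\quad\text{s.t.}\quad \int_0^uy(s)\,ds-\psi^*(y(u))\le\beta\,\psi(u)\ \ \forall u\in[0,u'],\quad y(u')=0,\quad y\in C[0,u'].$$
   Context: $\psi$ is extended by $-\infty$ on $(-\infty,0)$, and $\psi^*(y)=\inf_u\, yu-\psi(u)$ is its concave conjugate. The optimization variables are the continuous function $y$ and the scalar $\beta$. *)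

(* Defs.v *)
From HB Require Import structures.
From mathcomp Require Import all_boot all_order all_algebra.
From mathcomp Require Import all_classical all_reals all_analysis.

Set Implicit Arguments.
Unset Strict Implicit.
Unset Printing Implicit Defensive.

Import Order.TTheory GRing.Theory Num.Theory.
Import numFieldNormedType.Exports.

Local Open Scope classical_set_scope.
Local Open Scope ring_scope.

(* A function on R_+ is represented by a total function R -> R of which only
   the values on `[0, +oo[ are used; the set D below is its domain. *)

(* The neighbourhoods are relative to D. *)
Definition upper_semicontinuous_on (R : realType) (D : set R) (f : R -> R) :
    Prop :=
  forall x a : R, D x -> f x < a -> \forall z \near within D (nbhs x), f z < a.

Definition concave_on (R : realType) (D : set R) (f : R -> R) : Prop :=
  convex_function (E := R^o) D (fun x => - f x).

Definition extend_ninfty (R : realType) (psi : R -> R) (u : R) : \bar R :=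
  if 0 <= u then (psi u)%:E else -oo%E.

(* Takes the value -oo when the infimum is not finite; it is never +oo when
   psi 0 = 0, so the difference in [constraint] is always well defined. *)
Definition concave_conjugate (R : realType) (psi : R -> R) (y : R) : \bar R :=
  ereal_inf [set ((y * u)%:E - extend_ninfty psi u)%E | u in [set: R]].

Definition constraint (R : realType) (psi y : R -> R) (beta u : R) : Prop :=
  ((\int[@lebesgue_measure R]_(s in `[0%R, u]) (y s)%:E)
     - concave_conjugate psi (y u) <= (beta * psi u)%:E)%E.

Definition feasible_halfline (R : realType) (psi y : R -> R) (beta : R) : Prop :=
  {within `[0, +oo[, continuous y} /\
  (forall u : R, 0 <= u -> constraint psi y beta u).

Definition feasible_segment (R : realType) (psi : R -> R) (u' : R) (y : R -> R)
    (beta : R) : Prop :=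
  [/\ {within `[0, u'], continuous y},
      y u' = 0
    & forall u : R, 0 <= u <= u' -> constraint psi y beta u].

(* +oo if the problem is infeasible, -oo if it is unbounded below. *)
Definition optimal_value (R : realType) (feasible : (R -> R) -> R -> Prop) :
    \bar R :=
  ereal_inf [set beta%:E | beta in [set beta | exists y, feasible y beta]].

(* Main.v *)
Require Import Defs.
From HB Require Import structures.
From mathcomp Require Import all_boot all_order all_algebra.
From mathcomp Require Import all_classical all_reals all_analysis.
From mathcomp Require Import ring lra.

Import Order.TTheory GRing.Theory Num.Theory.
Import numFieldNormedType.Exports.

Local Open Scope classical_set_scope.
Local Open Scope ring_scope.

(** Extending a solution on [[0, u']] by [0] gives a solution on the half-line.
    Conversely, a half-line solution [y] is nonnegative, and since its integral
    is bounded, [y] is arbitrarily small at some points beyond [u']; as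
    [- psi^*(y) >= c - y u'], this yields [\int_0^u' y + c <= beta c].  Hence
    for any [eps > 0] one may multiply [y] by a cutoff vanishing at [u']: where
    the cutoff differs from [1] the left-hand side of the constraint is at most
    [beta c], and by concavity [psi u >= c u / u'], so
    [beta c <= (beta + eps) psi u] near [u']. *)

(** * Integrals, the constraint and concavity *)

Lemma within_continuous_integrable_segment (R : realType) (y : R -> R)
    (a b : R) :
  {within `[a, b], continuous y} ->
  (@lebesgue_measure R).-integrable `[a, b] (EFin \o y).
Proof.
by move=> cy; apply: continuous_compact_integrable => //; exact: segment_compact.
Qed.

(* Valid also when [concave_conjugate psi (y u)] is [-oo]. *)
Lemma constraintE (R : realType) (psi y : R -> R) (beta u : R) :
  {within `[0, u], continuous y} ->
  constraint psi y beta u <->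
  (forall v, 0 <= v ->
     \int[@lebesgue_measure R]_(s in `[0, u]) y s + (psi v - y u * v)
       <= beta * psi u).
Proof.
move=> cy; rewrite /constraint.
have fin_int : (\int[@lebesgue_measure R]_(s in `[0%R, u]) (y s)%:E)%E
    \is a fin_num.
  apply: integrable_fin_num => //.
  exact: within_continuous_integrable_segment.
rewrite -(fineK fin_int) -/(Rintegral _ _ _).
set i := Rintegral _ _ _.
have -> : ((i%:E - concave_conjugate psi (y u) <= (beta * psi u)%:E) =
    ((i - beta * psi u)%:E <= concave_conjugate psi (y u)))%E.
  case: (concave_conjugate psi (y u)) => [r| |] //=.
  - by rewrite !lee_fin; apply/idP/idP; lra.
  - by rewrite leNye leey.
split=> [/ereal_infP H v v0|H].
  have := H _ (ex_intro2 _ _ v I erefl).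
  by rewrite /extend_ninfty v0 -EFinB lee_fin; lra.
(* For [v < 0] the extension of [psi] is [-oo], so the term under the infimum is [+oo] and imposes
   nothing. *)
apply/ereal_infP => _ [v _ <-]; rewrite /extend_ninfty.
case: ifPn => [v0|_]; last by rewrite leey.
by rewrite -EFinB lee_fin; have := H v v0; lra.
Qed.

(** Used with [k = 0] for monotonicity of the integral in its endpoint, and with [k > 0] to make it
    grow past any bound. *)
Lemma le_Rintegral_increment (R : realType) (y : R -> R) (k a b : R) :
  0 <= a <= b -> {within `[0, b], continuous y} ->
  (forall s, a <= s <= b -> k <= y s) ->
  k * (b - a) <= \int[@lebesgue_measure R]_(s in `[0, b]) y s
                 - \int[@lebesgue_measure R]_(s in `[0, a]) y s.
Proof.
move=> /andP[a0 ab] cy ky.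
have iy := within_continuous_integrable_segment R y 0 b cy.
rewrite Rintegral_itvB ?bnd_simp//.
have -> : k * (b - a) = \int[@lebesgue_measure R]_(s in `]a, b]) k.
  rewrite Rintegral_cst//= lebesgue_measure_itv/= lte_fin.
  case: ltP => //= ba; congr (_ * _); lra.
apply: le_Rintegral => //.
- have ik : (@lebesgue_measure R).-integrable `[0, b] (EFin \o cst k).
    apply: within_continuous_integrable_segment.
    by apply: continuous_subspaceT => ?; exact: cvg_cst.
  by apply: integrableS ik => // s /=; rewrite !in_itv/=; lra.
- by apply: integrableS iy => // s /=; rewrite !in_itv/=; lra.
- by move=> s /=; rewrite in_itv/= => /andP[/ltW ? ?]; apply: ky; apply/andP.
Qed.

(** Concavity at [u], the convex combination of [v] and [0] with weight [u / v] on [v]. *)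
Lemma concave_on_ge_chord (R : realType) (psi : R -> R) (v u : R) :
  concave_on `[0, +oo[ psi -> psi 0 = 0 -> 0 < v -> 0 <= u <= v ->
  u * psi v <= v * psi u.
Proof.
move=> conc psi0 v0 /andP[u0 uv].
have t0 : 0 <= u / v by rewrite divr_ge0// ltW.
have t1 : u / v <= 1 by rewrite ler_pdivrMr// mul1r.
have vD : (v : convex_lmodType R^o) \in `[0, +oo[%classic.
  by rewrite inE/= in_itv/= andbT ltW.
have oD : (0 : convex_lmodType R^o) \in `[0, +oo[%classic.
  by rewrite inE/= in_itv/= lexx.
have := conc (Itv01 t0 t1) v 0 vD oD.
rewrite !convRE/= psi0.
have conv_u : u / v * v + (1 - u / v) * 0 = u.
  by rewrite mulr0 addr0 divfK// gt_eqF.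
rewrite -[X in - psi X <= _]/(u / v * v + (1 - u / v) * 0) conv_u.
rewrite oppr0 mulr0 addr0 mulrN lerN2 mulrAC ler_pdivrMr//.
by rewrite (mulrC v).
Qed.

(** A negative slope [y u] would make [psi v - y u * v] unbounded in [v], that is, the conjugate
    [-oo]. *)
Lemma constraint_nonneg (R : realType) (psi y : R -> R) (beta u : R) :
  {within `[0, u], continuous y} -> (forall v, 0 <= v -> 0 <= psi v) ->
  constraint psi y beta u -> 0 <= y u.
Proof.
move=> cy psi_ge0 /(constraintE _ _ _ _ _ cy).
set i := Rintegral _ _ _ => H; rewrite leNgt; apply/negP => y0.
(* Chosen so that [- y u * v] alone exceeds the slack [beta * psi u - i]. *)
pose v := (`|beta * psi u - i| + 1) / - y u.
have v0 : 0 <= v by rewrite divr_ge0 ?addr_ge0// oppr_ge0 ltW.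
have := H v v0; have := psi_ge0 v v0.
have -> : y u * v = - (`|beta * psi u - i| + 1).
  by rewrite /v; field; rewrite lt_eqF.
by have := ler_norm (beta * psi u - i); lra.
Qed.

(** The loss of [eps] accommodates the cutoff, which in general does not preserve [beta] itself. *)
Lemma le_optimal_value (R : realType) (P Q : (R -> R) -> R -> Prop) :
  (forall y beta, Q y beta -> forall eps, 0 < eps -> exists z, P z (beta + eps)) ->
  (optimal_value P <= optimal_value Q)%E.
Proof.
move=> H; apply/ereal_infP => _ [beta [y Qy] <-].
apply/lee_addgt0Pr => eps eps0; have [z Pz] := H y beta Qy eps eps0.
by apply: ereal_inf_lbound; exists (beta + eps) => //; exists z.
Qed.

(** * From the segment to the half-line *)

Lemma feasible_segment_extend (R : realType) (psi : R -> R) (u' c : R)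
    (y : R -> R) (beta : R) :
  0 < u' -> (forall u, u' <= u -> psi u = c) ->
  feasible_segment psi u' y beta ->
  feasible_halfline psi (fun s => if s <= u' then y s else 0) beta.
Proof.
set z := fun s => _.
move=> u'0 psi_const [cy yu' H].
have zy s : s \in `[0, u']%classic -> y s = z s.
  by rewrite inE/= in_itv/= /z => /andP[_ ->].
have z0 s : u' <= s -> z s = 0.
  by rewrite /z le_eqVlt => /predU1P[<-|us]; rewrite ?lexx// leNgt us.
(* Pasting along two closed sets that meet at [u'], where [y u' = 0] makes both pieces agree. *)
have cz : {within `[0, +oo[, continuous z}.
  have -> : `[0, +oo[%classic = (`[0, u'] `|` `[u', +oo[)%classic :> set R.
    apply/seteqP; split=> s /=; rewrite !in_itv/= ?andbT.
      by move=> ->; have [|/ltW] := leP s u'; [left|right].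
    by move=> [/andP[]//|]; apply: le_trans; exact: ltW.
  apply: withinU_continuous; [exact: interval_closed|exact: interval_closed| |].
    by apply: (@subspace_eq_continuous _ _ _ y) cy => s /zy.
  apply: (@subspace_eq_continuous _ _ _ (cst 0)).
    by move=> s; rewrite inE/= in_itv/= andbT => us; exact/esym/z0.
  by apply: continuous_subspaceT => ?; exact: cvg_cst.
have czs u : {within `[0, u], continuous z}.
  by apply: continuous_subspaceW cz => s /=; rewrite !in_itv/= andbT => /andP[].
have eq_int u : 0 <= u <= u' -> \int[@lebesgue_measure R]_(s in `[0, u]) z s =
    \int[@lebesgue_measure R]_(s in `[0, u]) y s.
  move=> /andP[u0 uu']; apply: eq_Rintegral => s.
  rewrite inE/= in_itv/= => /andP[s0 su]; rewrite -zy// inE/= in_itv/= s0.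
  exact: le_trans su uu'.
have Hy u v : 0 <= u <= u' -> 0 <= v ->
    \int[@lebesgue_measure R]_(s in `[0, u]) y s + (psi v - y u * v)
      <= beta * psi u.
  move=> uu'; apply: (constraintE _ _ _ _ _ _).1 (H u uu') v.
  apply: continuous_subspaceW cy => s /=; rewrite !in_itv/=.
  by case/andP: uu'; lra.
split=> // u u0; apply/constraintE => // v v0.
have [uu'|/ltW u'u] := leP u u'.
  rewrite eq_int ?u0// -zy ?inE/= ?in_itv/= ?u0//.
  by apply: Hy => //; rewrite u0.
(* Past [u'] the slope is [0], [psi] is [c] and the integral stops growing, so the constraint
   reduces to the one at [u']. *)
have u'0' : 0 <= u' <= u' by rewrite lexx ltW.
have := Hy u' v u'0' v0; rewrite yu' -eq_int// z0// (psi_const u')// (psi_const u)//.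
suff : \int[@lebesgue_measure R]_(s in `[0, u]) z s <=
       \int[@lebesgue_measure R]_(s in `[0, u']) z s by lra.
(* An upper bound on the increment is wanted, so the lower bound is applied to [- z]. *)
have cN : {within `[0, u], continuous (fun s => - z s)}.
  by move=> s; apply: cvgN; exact: czs.
have RintN b : \int[@lebesgue_measure R]_(s in `[0, b]) (- z s) =
   - \int[@lebesgue_measure R]_(s in `[0, b]) z s.
  under eq_Rintegral do rewrite -mulN1r.
  rewrite RintegralZl ?mulN1r//.
  exact: within_continuous_integrable_segment.
have : 0 * (u - u') <= \int[@lebesgue_measure R]_(s in `[0, u]) (- z s) -
    \int[@lebesgue_measure R]_(s in `[0, u']) (- z s).
  apply: le_Rintegral_increment => //; first by rewrite u'u ltW.
  by move=> s /andP[us _]; rewrite z0// oppr0.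
by rewrite !RintN; lra.
Qed.

(** * From the half-line to the segment *)

Lemma feasible_halfline_tail (R : realType) (psi : R -> R) (u' c : R)
    (y : R -> R) (beta : R) :
  0 < u' -> (forall u, u' <= u -> psi u = c) ->
  (forall v, 0 <= v -> 0 <= psi v) ->
  feasible_halfline psi y beta ->
  \int[@lebesgue_measure R]_(s in `[0, u']) y s + c <= beta * c.
Proof.
move=> u'0 psi_const psi_ge0 [cy H].
have cys u : {within `[0, u], continuous y}.
  by apply: continuous_subspaceW cy => s /=; rewrite !in_itv/= andbT => /andP[].
have y0 u : 0 <= u -> 0 <= y u.
  by move=> u0; apply: constraint_nonneg psi_ge0 (H u u0).
have Hy u v : u' <= u -> 0 <= v ->
    \int[@lebesgue_measure R]_(s in `[0, u]) y s + (psi v - y u * v)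
      <= beta * c.
  move=> u'u v0; rewrite -(psi_const u u'u).
  by apply: (constraintE _ _ _ _ _ _).1 (H u _) v v0 => //; lra.
rewrite leNgt; apply/negP.
set i := Rintegral _ _ _ => lt_i.
(* Were the claim false, testing the constraint at any [u >= u'] with [v = u'] would force
   [y u >= k > 0]. *)
pose k := (i + c - beta * c) / u'.
have k0 : 0 < k by rewrite divr_gt0//; lra.
have i0 : 0 <= i.
  by apply: Rintegral_ge0 => s /=; rewrite in_itv/= => /andP[/y0].
have yk u : u' <= u -> k <= y u.
  move=> u'u; rewrite ler_pdivrMr//.
  have := Hy u u' u'u (ltW u'0); rewrite psi_const//.
  suff : 0 * (u - u') <= \int[@lebesgue_measure R]_(s in `[0, u]) y s - i.
    by lra.
  apply: le_Rintegral_increment => //; first by rewrite u'u ltW.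
  by move=> s /andP[u's _]; apply: y0; lra.
(* Far enough for the integral to exceed [beta * c], contradicting the constraint tested with
   [v = 0]. *)
pose u := u' + (`|beta * c| + 1) / k.
have u'u : u' <= u by rewrite lerDl divr_ge0 ?addr_ge0// ltW.
have : k * (u - u') <= \int[@lebesgue_measure R]_(s in `[0, u]) y s - i.
  apply: le_Rintegral_increment => //; first by rewrite u'u ltW.
  by move=> s /andP[u's _]; apply: yk.
have -> : k * (u - u') = `|beta * c| + 1.
  by rewrite /u; field; rewrite gt_eqF.
have := Hy u 0 u'u (lexx 0); rewrite mulr0 -/i.
have := psi_ge0 0 (lexx 0); have := ler_norm (beta * c); lra.
Qed.

Lemma feasible_halfline_cutoff (R : realType) (psi : R -> R) (u' c : R)
    (y : R -> R) (beta eps : R) :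
  concave_on `[0, +oo[ psi -> psi 0 = 0 ->
  0 < u' -> (forall u, u' <= u -> psi u = c) -> 0 < c ->
  (forall v, 0 <= v -> 0 <= psi v <= c) ->
  feasible_halfline psi y beta -> 0 < eps ->
  exists z, feasible_segment psi u' z (beta + eps).
Proof.
move=> conc psi0 u'0 psi_const c0 psi_bnd yfeas eps0.
have psi_ge0 v : 0 <= v -> 0 <= psi v by move=> /psi_bnd/andP[].
have tail := feasible_halfline_tail R psi u' c y beta u'0 psi_const psi_ge0 yfeas.
have [cy H] := yfeas.
have cys u : {within `[0, u], continuous y}.
  by apply: continuous_subspaceW cy => s /=; rewrite !in_itv/= andbT => /andP[].
have y0 u : 0 <= u -> 0 <= y u.
  by move=> u0; apply: constraint_nonneg psi_ge0 (H u u0).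
have beta0 : 0 <= beta.
  rewrite -(pmulr_lge0 _ c0); apply: le_trans tail.
  rewrite addr_ge0 ?(ltW c0)//.
  by apply: Rintegral_ge0 => s /=; rewrite in_itv/= => /andP[/y0].
have be0 : 0 < beta + eps by rewrite ltr_wpDl.
(* Solves [(beta + eps) * (c * a / u') = beta * c]: from [a] on, the chord bound on [psi] gives
   [(beta + eps) * psi u >= beta * c]. *)
pose a := u' * (beta / (beta + eps)).
have au' : a < u' by rewrite gtr_pMr// ltr_pdivrMr// mul1r ltrDl.
have a0 : 0 <= a by rewrite !mulr_ge0 ?invr_ge0// ltW.
(* Equal to [1] up to [a], then affine down to [0] at [u']. *)
pose chi (s : R) := Num.min 1 ((u' - s) / (u' - a)).
have ua0 : 0 < u' - a by rewrite subr_gt0.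
have chi1 s : s <= a -> chi s = 1.
  move=> sa; apply/min_idPl; rewrite ler_pdivlMr// mul1r; lra.
have chi_ge0 s : s <= u' -> 0 <= chi s.
  by move=> su'; rewrite le_min ler01 divr_ge0// ?subr_ge0// ltW.
have chi_le1 s : chi s <= 1 by rewrite ge_min lexx.
pose z s := y s * chi s.
have cchi : continuous chi.
  move=> s; apply: (@continuous_min _ R (cst 1) (fun s => (u' - s) / (u' - a))).
    exact: cvg_cst.
  by apply: cvgMl; apply: cvgB; [exact: cvg_cst|exact: cvg_id].
have cz u : {within `[0, u], continuous z}.
  move=> s; apply: cvgM; first exact: cys.
  by apply: continuous_subspaceT; exact: cchi.
exists z; split; first exact: cz.
  by rewrite /z /chi subrr mul0r min_r ?mulr0.
move=> u /andP[u0 uu']; apply/constraintE => // v v0.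
have zy s : 0 <= s <= u' -> 0 <= z s <= y s.
  move=> /andP[s0 su']; rewrite mulr_ge0 ?y0 ?chi_ge0//=.
  by rewrite ler_piMr ?y0.
have int_le : \int[@lebesgue_measure R]_(s in `[0, u]) z s <=
              \int[@lebesgue_measure R]_(s in `[0, u]) y s.
  apply: le_Rintegral => //; try exact: within_continuous_integrable_segment.
  move=> s /=; rewrite in_itv/= => /andP[s0 su].
  by have /andP[] : 0 <= z s <= y s by apply: zy; rewrite s0 (le_trans su).
(* Up to [a] the slope is unchanged and the integral no larger, so the constraint for [y] carries
   over. Beyond [a], the term [- z u * v] is dropped and the rest is bounded by the tail
   estimate. *)
have [ua|/ltW au] := leP u a.
  have zu : z u = y u by rewrite /z chi1// mulr1.
  have le_y := (constraintE _ _ _ _ _ (cys u)).1 (H u u0) v v0.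
  have le_eps : 0 <= eps * psi u by rewrite mulr_ge0 ?psi_ge0// ltW.
  rewrite zu mulrDl; apply: (le_trans _ (lerD le_y le_eps)).
  by rewrite addr0 lerD2r.
have int_mon : \int[@lebesgue_measure R]_(s in `[0, u]) y s <=
              \int[@lebesgue_measure R]_(s in `[0, u']) y s.
  rewrite -subr_ge0 -[leLHS](mul0r (u' - u)).
  apply: le_Rintegral_increment => //; first by rewrite u0.
  by move=> s /andP[us _]; apply: y0; lra.
have zv : 0 <= z u * v.
  by rewrite mulr_ge0//; have /andP[] : 0 <= z u <= y u by apply: zy; rewrite u0.
have psi_near : beta * c <= (beta + eps) * psi u.
  have : u * psi u' <= u' * psi u by apply: concave_on_ge_chord; rewrite ?u0.
  rewrite psi_const// => chord.
  rewrite -(ler_pM2l u'0).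
  apply: (@le_trans _ _ ((beta + eps) * (u * c))).
    have -> : u' * (beta * c) = (beta + eps) * (a * c).
      by rewrite /a; field; rewrite gt_eqF.
    by rewrite ler_pM2l// ler_pM2r.
  by rewrite [leRHS]mulrCA ler_pM2l.
have /andP[_ psivc] := psi_bnd v v0.
apply: le_trans (le_trans tail psi_near); apply: lerD.
  exact: le_trans int_le int_mon.
by rewrite lerBlDr (le_trans psivc)// lerDl.
Qed.

Theorem theorem2 (R : realType) (psi : R -> R) (u' c : R)
  (psi_usc : upper_semicontinuous_on `[0, +oo[ psi)
  (psi_concave : concave_on `[0, +oo[ psi)
  (psi_ndecr : {in `[0, +oo[ &, {homo psi : x y / x <= y}})
  (psi0 : psi 0 = 0)
  (u'_gt0 : 0 < u')
  (psi_const : forall u : R, u' <= u -> psi u = c) :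
  optimal_value (feasible_halfline psi) =
  optimal_value (feasible_segment psi u').
Proof.
have psi_mon x y : 0 <= x -> x <= y -> psi x <= psi y.
  by move=> x0 xy; apply: psi_ndecr; rewrite ?in_itv/= ?andbT//; lra.
have psi_bnd v : 0 <= v -> 0 <= psi v <= c.
  move=> v0; rewrite -{1}psi0 psi_mon//=.
  (* [c] is the value of [psi] at a point beyond both [u'] and [v]. *)
  rewrite -(psi_const (Num.max u' v)) ?le_max ?lexx// psi_mon//.
  by rewrite le_max lexx orbT.
have c_ge0 : 0 <= c by have /andP[] := psi_bnd u' (ltW u'_gt0); lra.
apply/eqP; rewrite eq_le; apply/andP; split; apply: le_optimal_value.
  move=> y beta [cy yu' H] eps eps0.
  exists (fun s => if s <= u' then y s else 0).
  apply: (feasible_segment_extend _ _ _ c) => //; split=> // u uu'.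
  (* Raising [beta] relaxes the constraint because [psi u >= 0]. *)
  apply: le_trans (H u uu') _; rewrite lee_fin ler_wpM2r ?lerDl ?(ltW eps0)//.
  by case/andP: uu' => /psi_bnd/andP[].
move=> y beta yfeas eps eps0; have [c0|c_neq0] := eqVneq c 0; last first.
  apply: (feasible_halfline_cutoff _ _ _ c) yfeas eps0 => //.
  by rewrite lt_neqAle eq_sym c_neq0.
(* If [c = 0], then [psi] vanishes on the half-line and the zero function is feasible for every
   [beta], even a negative one. *)
have psi_eq0 v : 0 <= v -> psi v = 0.
  by move=> /psi_bnd; rewrite c0 -eq_le => /eqP.
have c0s (A : set R) : {within A, continuous (cst 0 : R -> R)}.
  by apply: continuous_subspaceT => ?; exact: cvg_cst.
exists (cst 0); split=> // u /andP[u0 _]; apply/constraintE => // v v0.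
by rewrite Rintegral_cst// !mul0r !psi_eq0// mulr0 subr0 addr0.
Qed.
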